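(* Let $n\geq 0$ be an integer. The higher order Horadam 3-parameter generalized quaternions satisfy the Binet formula $$\mathbf{Q}W_{n}(s)=\frac{A\alpha^{sn}\Theta_{\alpha}(s)-B\beta^{sn}\Theta_{\beta}(s)}{A\alpha^{s}-B\beta^{s}},$$ where $\Theta_{\alpha}(s)=\mathbf{1}+\alpha^{s}\mathbf{i}+\alpha^{2s}\mathbf{j}+\alpha^{3s}\mathbf{k}$ and $\Theta_{\beta}(s)=\mathbf{1}+\beta^{s}\mathbf{i}+\beta^{2s}\mathbf{j}+\beta^{3s}\mathbf{k}$.
   Context: Let $\alpha,\beta$ be distinct nonzero real numbers, $W_0,W_1$ real numbers, $A=W_1-W_0\beta$, $B=W_1-W_0\alpha$, and let $W_n=\frac{A\alpha^n-B\beta^n}{\alpha-\beta}$ ($n\geq 0$) be the Horadam numbers. Fix an integer $s\geq 1$ with $W_s\neq 0$, equivalently $A\alpha^s-B\beta^s\neq 0$. The higher order Horadam numbers are $W_n(s)=\frac{W_{sn}}{W_s}=\frac{A\alpha^{sn}-B\beta^{sn}}{A\alpha^s-B\beta^s}$, $n\geq 0$. Let $\lambda_1,\lambda_2,\lambda_3$ be real parameters. The 3-parameter generalized quaternions form the real algebra of elements $x_0\mathbf{1}+x_1\mathbf{i}+x_2\mathbf{j}+x_3\mathbf{k}$ ($x_r\in\mathbb{R}$) with basis $\mathbf{1},\mathbf{i},\mathbf{j},\mathbf{k}$ and bilinear multiplication in which $\mathbf{1}$ is the identity and $\mathbf{i}^2=-\lambda_1\lambda_2\mathbf{1}$, $\mathbf{j}^2=-\lambda_1\lambda_3\mathbf{1}$,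 $\mathbf{k}^2=-\lambda_2\lambda_3\mathbf{1}$, $\mathbf{i}\mathbf{j}=\lambda_1\mathbf{k}=-\mathbf{j}\mathbf{i}$, $\mathbf{j}\mathbf{k}=\lambda_3\mathbf{i}=-\mathbf{k}\mathbf{j}$, $\mathbf{k}\mathbf{i}=\lambda_2\mathbf{j}=-\mathbf{i}\mathbf{k}$. The higher order Horadam 3-parameter generalized quaternions are $\mathbf{Q}W_n(s)=W_n(s)\mathbf{1}+W_{n+1}(s)\mathbf{i}+W_{n+2}(s)\mathbf{j}+W_{n+3}(s)\mathbf{k}$, $n\geq 0$. *)

(* Defs.v *)
From HB Require Import structures.
From mathcomp Require Import all_boot all_order all_algebra.
From mathcomp Require Import ring.
From mathcomp Require Export reals.

Set Implicit Arguments.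
Unset Strict Implicit.
Unset Printing Implicit Defensive.

Import GRing.Theory.
Local Open Scope ring_scope.

(* GQuat x0 x1 x2 x3 stands for x0 1 + x1 i + x2 j + x3 k (gquatE below); the
   parameters l1 l2 l3 only occur in the product. *)
Record gquat (R : comNzRingType) (l1 l2 l3 : R) := GQuat {
  gq0 : R; gq1 : R; gq2 : R; gq3 : R }.
Arguments GQuat {R l1 l2 l3} _ _ _ _.

Definition gquat_to (R : comNzRingType) (l1 l2 l3 : R) (x : gquat l1 l2 l3) :
  R * R * R * R := (gq0 x, gq1 x, gq2 x, gq3 x).
Definition gquat_of (R : comNzRingType) (l1 l2 l3 : R) (t : R * R * R * R) :
  gquat l1 l2 l3 := let: (x0, x1, x2, x3) := t in GQuat x0 x1 x2 x3.

Lemma gquat_toK (R : comNzRingType) (l1 l2 l3 : R) :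
  cancel (@gquat_to R l1 l2 l3) (@gquat_of R l1 l2 l3).
Proof. by case. Qed.

HB.instance Definition _ (R : comNzRingType) (l1 l2 l3 : R) :=
  Choice.copy (gquat l1 l2 l3) (can_type (@gquat_toK R l1 l2 l3)).

Definition gq_zero (R : comNzRingType) (l1 l2 l3 : R) : gquat l1 l2 l3 :=
  GQuat 0 0 0 0.
Definition gq_opp (R : comNzRingType) (l1 l2 l3 : R) (x : gquat l1 l2 l3) :
  gquat l1 l2 l3 := GQuat (- gq0 x) (- gq1 x) (- gq2 x) (- gq3 x).
Definition gq_add (R : comNzRingType) (l1 l2 l3 : R) (x y : gquat l1 l2 l3) :
  gquat l1 l2 l3 :=
  GQuat (gq0 x + gq0 y) (gq1 x + gq1 y) (gq2 x + gq2 y) (gq3 x + gq3 y).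
Definition gq_one (R : comNzRingType) (l1 l2 l3 : R) : gquat l1 l2 l3 :=
  GQuat 1 0 0 0.
Definition gq_scale (R : comNzRingType) (l1 l2 l3 : R) (a : R)
    (x : gquat l1 l2 l3) : gquat l1 l2 l3 :=
  GQuat (a * gq0 x) (a * gq1 x) (a * gq2 x) (a * gq3 x).
(* Bilinear extension of the multiplication table; the table itself is
   recovered in gquat_table below. *)
Definition gq_mul (R : comNzRingType) (l1 l2 l3 : R) (x y : gquat l1 l2 l3) :
  gquat l1 l2 l3 :=
  let: GQuat x0 x1 x2 x3 := x in let: GQuat y0 y1 y2 y3 := y in
  GQuat
    (x0 * y0 - l1 * l2 * (x1 * y1) - l1 * l3 * (x2 * y2) - l2 * l3 * (x3 * y3))
    (x0 * y1 + x1 * y0 + l3 * (x2 * y3 - x3 * y2))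
    (x0 * y2 + x2 * y0 + l2 * (x3 * y1 - x1 * y3))
    (x0 * y3 + x3 * y0 + l1 * (x1 * y2 - x2 * y1)).

Fact gq_addA (R : comNzRingType) (l1 l2 l3 : R) :
  associative (@gq_add R l1 l2 l3).
Proof. by move=> [????] [????] [????]; rewrite /gq_add /= !addrA. Qed.
Fact gq_addC (R : comNzRingType) (l1 l2 l3 : R) :
  commutative (@gq_add R l1 l2 l3).
Proof. by move=> [????] [????]; congr GQuat; rewrite addrC. Qed.
Fact gq_add0 (R : comNzRingType) (l1 l2 l3 : R) :
  left_id (gq_zero l1 l2 l3) (@gq_add R l1 l2 l3).
Proof. by move=> [????]; rewrite /gq_add /= !add0r. Qed.
Fact gq_addN (R : comNzRingType) (l1 l2 l3 : R) :
  left_inverse (gq_zero l1 l2 l3) (@gq_opp R l1 l2 l3) (@gq_add R l1 l2 l3).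
Proof. by move=> [????]; rewrite /gq_add /= !addNr. Qed.

HB.instance Definition _ (R : comNzRingType) (l1 l2 l3 : R) :=
  GRing.isZmodule.Build (gquat l1 l2 l3) (@gq_addA R l1 l2 l3)
    (@gq_addC R l1 l2 l3) (@gq_add0 R l1 l2 l3) (@gq_addN R l1 l2 l3).

Fact gq_mulA (R : comNzRingType) (l1 l2 l3 : R) :
  associative (@gq_mul R l1 l2 l3).
Proof. by move=> [????] [????] [????]; congr GQuat; ring. Qed.
Fact gq_mul1x (R : comNzRingType) (l1 l2 l3 : R) :
  left_id (gq_one l1 l2 l3) (@gq_mul R l1 l2 l3).
Proof. by move=> [????]; congr GQuat; ring. Qed.
Fact gq_mulx1 (R : comNzRingType) (l1 l2 l3 : R) :
  right_id (gq_one l1 l2 l3) (@gq_mul R l1 l2 l3).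
Proof. by move=> [????]; congr GQuat; ring. Qed.
Fact gq_mulDl (R : comNzRingType) (l1 l2 l3 : R) :
  left_distributive (@gq_mul R l1 l2 l3) (@gq_add R l1 l2 l3).
Proof. by move=> [????] [????] [????]; congr GQuat; rewrite /=; ring. Qed.
Fact gq_mulDr (R : comNzRingType) (l1 l2 l3 : R) :
  right_distributive (@gq_mul R l1 l2 l3) (@gq_add R l1 l2 l3).
Proof. by move=> [????] [????] [????]; congr GQuat; rewrite /=; ring. Qed.
Fact gq_one_neq0 (R : comNzRingType) (l1 l2 l3 : R) :
  gq_one l1 l2 l3 != 0.
Proof. by apply/eqP => /(congr1 (@gq0 _ _ _ _)) /eqP; rewrite oner_eq0. Qed.

HB.instance Definition _ (R : comNzRingType) (l1 l2 l3 : R) :=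
  GRing.Zmodule_isNzRing.Build (gquat l1 l2 l3) (@gq_mulA R l1 l2 l3)
    (@gq_mul1x R l1 l2 l3) (@gq_mulx1 R l1 l2 l3) (@gq_mulDl R l1 l2 l3)
    (@gq_mulDr R l1 l2 l3) (@gq_one_neq0 R l1 l2 l3).

Fact gq_scaleA (R : comNzRingType) (l1 l2 l3 : R) (a b : R)
  (x : gquat l1 l2 l3) : gq_scale a (gq_scale b x) = gq_scale (a * b) x.
Proof. by rewrite /gq_scale /= !mulrA. Qed.
Fact gq_scale1 (R : comNzRingType) (l1 l2 l3 : R) :
  left_id 1 (@gq_scale R l1 l2 l3).
Proof. by move=> [????]; rewrite /gq_scale /= !mul1r. Qed.
Fact gq_scaleDr (R : comNzRingType) (l1 l2 l3 : R) :
  right_distributive (@gq_scale R l1 l2 l3) +%R.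
Proof. by move=> a [????] [????]; congr GQuat; rewrite mulrDr. Qed.
Fact gq_scaleDl (R : comNzRingType) (l1 l2 l3 : R) (x : gquat l1 l2 l3) :
  {morph (@gq_scale R l1 l2 l3)^~ x : a b / a + b}.
Proof. by move=> a b; congr GQuat; rewrite mulrDl. Qed.

HB.instance Definition _ (R : comNzRingType) (l1 l2 l3 : R) :=
  GRing.Zmodule_isLmodule.Build R (gquat l1 l2 l3) (@gq_scaleA R l1 l2 l3)
    (@gq_scale1 R l1 l2 l3) (@gq_scaleDr R l1 l2 l3) (@gq_scaleDl R l1 l2 l3).

Fact gq_scaleAl (R : comNzRingType) (l1 l2 l3 : R) (a : R)
  (x y : gquat l1 l2 l3) : a *: (x * y) = a *: x * y.
Proof. by case: x y => [????] [????]; congr GQuat; rewrite /=; ring. Qed.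

HB.instance Definition _ (R : comNzRingType) (l1 l2 l3 : R) :=
  GRing.Lmodule_isLalgebra.Build R (gquat l1 l2 l3) (@gq_scaleAl R l1 l2 l3).

Fact gq_scaleAr (R : comNzRingType) (l1 l2 l3 : R) (a : R)
  (x y : gquat l1 l2 l3) : a *: (x * y) = x * (a *: y).
Proof. by case: x y => [????] [????]; congr GQuat; rewrite /=; ring. Qed.

HB.instance Definition _ (R : comNzRingType) (l1 l2 l3 : R) :=
  GRing.Lalgebra_isAlgebra.Build R (gquat l1 l2 l3) (@gq_scaleAr R l1 l2 l3).

Definition gq_i (R : comNzRingType) (l1 l2 l3 : R) : gquat l1 l2 l3 :=
  GQuat 0 1 0 0.
Definition gq_j (R : comNzRingType) (l1 l2 l3 : R) : gquat l1 l2 l3 :=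
  GQuat 0 0 1 0.
Definition gq_k (R : comNzRingType) (l1 l2 l3 : R) : gquat l1 l2 l3 :=
  GQuat 0 0 0 1.

Lemma gquatE (R : comNzRingType) (l1 l2 l3 x0 x1 x2 x3 : R) :
  GQuat x0 x1 x2 x3 = x0 *: 1 + x1 *: gq_i l1 l2 l3 + x2 *: gq_j l1 l2 l3
                      + x3 *: gq_k l1 l2 l3.
Proof. by congr GQuat; rewrite /=; ring. Qed.

Lemma gquat_table (R : comNzRingType) (l1 l2 l3 : R) :
  let i := gq_i l1 l2 l3 in let j := gq_j l1 l2 l3 in
  let k := gq_k l1 l2 l3 in
  [/\ [/\ i * i = - (l1 * l2) *: 1, j * j = - (l1 * l3) *: 1
        & k * k = - (l2 * l3) *: 1],
      i * j = l1 *: k /\ j * i = - (l1 *: k),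
      j * k = l3 *: i /\ k * j = - (l3 *: i)
    & k * i = l2 *: j /\ i * k = - (l2 *: j)].
Proof. by do !split; congr GQuat; rewrite /=; ring. Qed.

(* The Horadam number W_n, for A = W1 - W0 beta and B = W1 - W0 alpha. *)
Definition horadam (R : fieldType) (alpha beta W0 W1 : R) (n : nat) : R :=
  ((W1 - W0 * beta) * alpha ^+ n - (W1 - W0 * alpha) * beta ^+ n)
  / (alpha - beta).

Definition ho_horadam (R : fieldType) (alpha beta W0 W1 : R) (s n : nat) : R :=
  horadam alpha beta W0 W1 (s * n) / horadam alpha beta W0 W1 s.

Definition ho_horadam_gquat (R : fieldType) (l1 l2 l3 alpha beta W0 W1 : R)
    (s n : nat) : gquat l1 l2 l3 :=
  let W := ho_horadam alpha beta W0 W1 s in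
  W n *: 1 + W (n + 1)%N *: gq_i l1 l2 l3 + W (n + 2)%N *: gq_j l1 l2 l3
  + W (n + 3)%N *: gq_k l1 l2 l3.

Definition Theta (R : fieldType) (l1 l2 l3 x : R) (s : nat) :
    gquat l1 l2 l3 :=
  1 + x ^+ s *: gq_i l1 l2 l3 + x ^+ (2 * s) *: gq_j l1 l2 l3
  + x ^+ (3 * s) *: gq_k l1 l2 l3.

(* Main.v *)
Require Import Defs.
From mathcomp Require Import all_boot all_order all_algebra reals.
From mathcomp Require Import ring.
Import GRing.Theory.
Local Open Scope ring_scope.

(** In the quotient of W_(sn) by W_s the common denominator [alpha - beta] cancels ([ho_horadamE]).
    Hence coordinate r = 0, ..., 3 of the quaternion has numerator A alpha^(s(n+r)) - B
    beta^(s(n+r)) over a denominator independent of r. Since alpha^(s(n+r)) = alpha^(sn) alpha^(rs),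
    and likewise for beta, the second factors are the coordinates of [Theta]. *)

Lemma ho_horadamE (R : fieldType) (alpha beta W0 W1 : R) (s n : nat) :
  alpha != beta ->
  ho_horadam alpha beta W0 W1 s n =
  ((W1 - W0 * beta) * alpha ^+ (s * n) - (W1 - W0 * alpha) * beta ^+ (s * n))
  / ((W1 - W0 * beta) * alpha ^+ s - (W1 - W0 * alpha) * beta ^+ s).
Proof.
move=> neq_ab; have d_neq0 : alpha - beta != 0 by rewrite subr_eq0.
by rewrite /ho_horadam /horadam invf_div mulrA divfK.
Qed.

Lemma ThetaE (R : fieldType) (l1 l2 l3 x : R) (s : nat) :
  Theta l1 l2 l3 x s = GQuat 1 (x ^+ s) (x ^+ (2 * s)) (x ^+ (3 * s)).
Proof. by rewrite gquatE scale1r. Qed.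

Theorem theorem2p3 (R : realType) (alpha beta W0 W1 l1 l2 l3 : R) (s n : nat)
    (alpha_neq_beta : alpha != beta) (alpha_neq0 : alpha != 0)
    (beta_neq0 : beta != 0) (s_ge1 : (1 <= s)%N)
    (Ws_neq0 : horadam alpha beta W0 W1 s != 0) :
  let A := W1 - W0 * beta in
  let B := W1 - W0 * alpha in
  ho_horadam_gquat l1 l2 l3 alpha beta W0 W1 s n =
  (A * alpha ^+ s - B * beta ^+ s)^-1 *:
    ((A * alpha ^+ (s * n)) *: Theta l1 l2 l3 alpha s
     - (B * beta ^+ (s * n)) *: Theta l1 l2 l3 beta s).
Proof.
move=> A B; rewrite /ho_horadam_gquat -gquatE !ThetaE !ho_horadamE // -/A -/B.
(* Exponents s(n+r) become sn + rs, with rs ordered as in [Theta], so that both sides contain the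
   same powers. *)
rewrite !mulnDr muln1 !(mulnC s 2) !(mulnC s 3) !exprD.
(* In each coordinate both sides become fractions over the same denominator, leaving a division-free
   identity of numerators. *)
by congr GQuat; rewrite /= [RHS]mulrC; congr (_ / _); ring.
Qed.
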